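(* For $n\ge 3$ let $W_n\in\mathbb{Z}[[z_1,\dots,z_n]]$ be the Poincaré–Hilbert series of the $\mathbb{Z}^n$-graded algebra $\mathbb{C}[X(\mathcal{T}_n)]$. Write $W_n=\sum_{i=0}^\infty w_i z_n^i$ with $w_i\in\mathbb{Z}[[z_1,\dots,z_{n-1}]]$. Then for every $n\ge 3$ $$W_{n+1}=\left(\sum_{i=0}^{\infty}w_i\cdot\Big(\sum_{l=0}^{i}z_n^{\,i-l}z_{n+1}^{\,l}\Big)\right)\cdot\frac{1}{1-z_nz_{n+1}} .$$
   Context: The tree $\mathcal{T}_n$ ($n\ge 3$). $\mathcal{T}_3$ is the tree with one interior vertex joined to three leaves $1,2,3$ by edges $1,2,3$ respectively. $\mathcal{T}_{n+1}$ is obtained from $\mathcal{T}_n$ by attaching to the last leaf (leaf $n$) of $\mathcal{T}_n$ (which becomes an interior vertex) two new leaves by two new edges numbered $2n-2$ and $2n-1$; the new leaf on edge $2n-2$ is leaf $n$ of $\mathcal{T}_{n+1}$, the new leaf on edge $2n-1$ is leaf $n+1$ of $\mathcal{T}_{n+1}$, and leaves $1,\dots,n-1$ and edges $1,\dots,2n-3$ keep their numbers. Thus $\mathcal{T}_n$ has $n$ leaves and $2n-3$ edges, and all interior vertices have degree $3$. For leaves $i<j$ of $\mathcal{T}_n$ let $w_{i,j}\in\mathbb{Z}^{2n-3}$ be the vector with ones on the coordinates of the edges of the path joining leaf $i$ to leaf $j$, and zeros elsewhere. Let $S(\mathcal{T}_n)=\{\sum_{i<j}a_{i,j}w_{i,j}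 : a_{i,j}\in\mathbb{Z}_{\ge0}\}\subset\mathbb{Z}^{2n-3}$ (a semigroup). $X_{aff}(\mathcal{T}_n)\subset\mathbb{C}^{n(n-1)/2}$ (coordinates $x_{i,j}$, $1\le i<j\le n$) is the Zariski closure of the image of $(\mathbb{C}^* )^{2n-3}$ under the map whose $(i,j)$ coordinate is the monomial with exponent vector $w_{i,j}$; it is the affine cone over a projective variety $X(\mathcal{T}_n)$, and $\mathbb{C}[X(\mathcal{T}_n)]$ denotes the coordinate ring of this cone, i.e. $\mathbb{C}[x_{i,j}]$ modulo the ideal of $X_{aff}(\mathcal{T}_n)$. It is isomorphic to the semigroup algebra $\mathbb{C}[S(\mathcal{T}_n)]$. It is $\mathbb{Z}^n$-graded by giving $x_{i,j}$ degree $r_{i,j}$, where $r_{i,j}\in\mathbb{Z}^n$ has ones at positions $i$ and $j$ and zeros elsewhere; equivalently, $a\in S(\mathcal{T}_n)$ has degree the vector of its values on the edges incident to leaves $1,\dots,n$. The Poincaré–Hilbert series of a $\mathbb{Z}^n$-graded module $M$ is $\sum_{\lambda\in\mathbb{Z}^n}\dim(M_\lambda)z^\lambda$, with $z^\lambda=z_1^{\lambda_1}\cdots z_n^{\lambda_n}$. *)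

(* Defs.v *)
From HB Require Import structures.
From mathcomp Require Import all_boot all_order all_algebra.
From mathcomp Require Import generic_quotient ring_quotient complex mpoly.
From mathcomp Require Import boolp classical_sets functions cardinality.
From mathcomp Require Import fsbigop reals.

Set Implicit Arguments.
Unset Strict Implicit.
Unset Printing Implicit Defensive.

Import Order.TTheory GRing.Theory Num.Theory.
Local Open Scope classical_set_scope.
Local Open Scope ring_scope.

(** * Formal power series in [z_1, ..., z_m] with integer coefficients *)

(* A series is its coefficient function; its product is the Cauchy product, not
   the pointwise one. *)
Definition fps (m : nat) : Type := 'X_{1..m} -> int.

HB.instance Definition _ m := GRing.Zmodule.copy (fps m) ('X_{1..m} -> int).

Section FpsRing.
Context (m : nat).
Implicit Types (f g h : fps m) (a mu : 'X_{1..m}).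

Definition fps_mon a : fps m := fun mu => (mu == a)%:R.

Definition fps_mul f g : fps m := fun mu =>
  \sum_(k : 'X_{1..m < (mdeg mu).+1} | (k <= mu)%MM) f k * g (mu - k)%MM.

(* The terms of degree less than [d], as a polynomial; the ring axioms are
   inherited from those of polynomials. *)
Let trunc d f : {mpoly int[m]} := \sum_(k : 'X_{1..m < d}) f k *: 'X_[k].

Let truncE d f mu : (mdeg mu < d)%N -> (trunc d f)@_mu = f mu.
Proof.
move=> lt_d; rewrite /trunc raddf_sum /= (bigD1 (BMultinom lt_d)) //=.
rewrite mcoeffZ mcoeffX eqxx mulr1 big1 ?addr0 // => k ne_k.
rewrite mcoeffZ mcoeffX; case: eqP => [eq_k|]; last by rewrite mulr0.
by case/eqP: ne_k; apply/eqP; rewrite bmeqP /= eq_k.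
Qed.

Let mulE d f g mu : (mdeg mu < d)%N ->
  fps_mul f g mu = (trunc d f * trunc d g)@_mu.
Proof.
move=> lt_d; rewrite (mcoeff_poly_mul_lin _ _ (ltnSn (mdeg mu))).
apply: eq_bigr => k le_k.
have lt_k : (mdeg k < d)%N by apply: leq_trans lt_d; exact: bmdeg.
by rewrite !truncE // (leq_ltn_trans (mdegB _ _)).
Qed.

Let mulEl d f g (p : {mpoly int[m]}) mu : (mdeg mu < d)%N ->
  (forall nu, (mdeg nu < d)%N -> f nu = p@_nu) ->
  fps_mul f g mu = (p * trunc d g)@_mu.
Proof.
move=> lt_d fp; rewrite (mulE f g lt_d) !(mcoeff_poly_mul_lin _ _ (ltnSn (mdeg mu))).
apply: eq_bigr => k le_k; rewrite truncE ?fp //;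
  by apply: leq_trans lt_d; exact: bmdeg.
Qed.

Let fps_mulC : commutative fps_mul.
Proof.
by move=> f g; apply/funext => mu; rewrite !(@mulE (mdeg mu).+1) // mulrC.
Qed.

Let fps_mulA : associative fps_mul.
Proof.
move=> f g h; apply/funext => mu; rewrite fps_mulC.
rewrite (@mulEl (mdeg mu).+1 _ _ (trunc (mdeg mu).+1 g * trunc (mdeg mu).+1 h));
  [|by []|by move=> nu ?; apply: mulE].
rewrite (@mulEl (mdeg mu).+1 _ _ (trunc (mdeg mu).+1 f * trunc (mdeg mu).+1 g));
  [|by []|by move=> nu ?; apply: mulE].
by rewrite mulrC mulrA.
Qed.

Let fps_mul1 : left_id (fps_mon 0%MM) fps_mul.
Proof.
move=> f; apply/funext => mu; rewrite (@mulEl (mdeg mu).+1 _ _ 1) //.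
  by rewrite mul1r truncE.
by move=> nu _; rewrite mcoeff1 /fps_mon; case: eqP.
Qed.

Let fps_mulD : left_distributive fps_mul +%R.
Proof.
move=> f g h; apply/funext => mu; rewrite /fps_mul -[RHS]/(_ + _) -big_split /=.
by apply: eq_bigr => k _; rewrite -mulrDl.
Qed.

Let fps_1_neq0 : fps_mon 0%MM != 0 :> fps m.
Proof. by apply/eqP => /(congr1 (@^~ 0%MM)) /eqP; rewrite /fps_mon eqxx. Qed.

HB.instance Definition _ := GRing.Zmodule_isComNzRing.Build (fps m)
  fps_mulA fps_mulC fps_mul1 fps_mulD fps_1_neq0.

Let fps_unit : pred (fps m) := fun f => `[< exists g, g * f = 1 >].
Let fps_inv f : fps m := xget f [set g | g * f = 1].

Let fps_mulVf : {in fps_unit, left_inverse 1 fps_inv *%R}.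
Proof.
by move=> f /asboolP uf; rewrite /fps_inv; apply: (xgetPex f uf).
Qed.

Let fps_unitP f g : g * f = 1 -> fps_unit f.
Proof. by move=> gf; apply/asboolP; exists g. Qed.

Let fps_inv_out : {in [predC fps_unit], fps_inv =1 id}.
Proof.
move=> f nuf; rewrite /fps_inv xgetPN // => g gf.
by case/negP: nuf; exact: fps_unitP gf.
Qed.

HB.instance Definition _ := GRing.ComNzRing_hasMulInverse.Build (fps m)
  fps_mulVf fps_unitP fps_inv_out.

Lemma fps_mulE f g mu : (f * g) mu =
  \sum_(k : 'X_{1..m < (mdeg mu).+1} | (k <= mu)%MM) f k * g (mu - k)%MM.
Proof. by []. Qed.

Lemma fps_mulXE f a mu :
  (f * fps_mon a) mu = if (a <= mu)%MM then f (mu - a)%MM else 0.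
Proof.
rewrite mulrC fps_mulE; case: ifPn => [le_a|nle_a].
  have lt_a : (mdeg a < (mdeg mu).+1)%N.
    by rewrite ltnS -(submK le_a) mdegD leq_addl.
  rewrite (bigD1 (BMultinom lt_a)) //= /fps_mon eqxx mul1r big1 ?addr0 //.
  move=> k /andP[_ ne_k]; case: eqP => [eq_k|]; last by rewrite mul0r.
  by case/eqP: ne_k; apply/eqP; rewrite bmeqP /= eq_k.
apply: big1 => k le_k; rewrite /fps_mon; case: eqP => [eq_k|].
  by rewrite -eq_k le_k in nle_a.
by rewrite mul0r.
Qed.

Lemma fps_monX a i : fps_mon a ^+ i = fps_mon (a *+ i)%MM.
Proof.
elim: i => [|i IHi]; first by rewrite expr0 mulm0n.
rewrite exprS IHi mulmS; apply/funext => mu; rewrite fps_mulXE /fps_mon.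
case: ifPn => [le_a|nle_a]; first by rewrite -(eqm_add2r (a *+ i)%MM) submK.
by case: eqP => // eq_mu; rewrite eq_mu lem_addl in nle_a.
Qed.

Lemma fps_unit_sub1 f : f 0%MM = 0 -> 1 - f \is a GRing.unit.
Proof.
move=> f0.
have fX k mu : (mdeg mu < k)%N -> (f ^+ k) mu = 0.
  elim: k mu => // k IHk mu lt_k; rewrite exprS fps_mulE big1 // => nu le_nu.
  have [->|nz_nu] := eqVneq (nu : 'X_{1..m}) 0%MM; first by rewrite f0 mul0r.
  rewrite IHk ?mulr0 //; rewrite ltnS in lt_k; apply: leq_trans lt_k.
  rewrite -[X in (_ < mdeg X)%N](submK le_nu) mdegD -[X in (X < _)%N]addn0.
  by rewrite ltn_add2l lt0n mdeg_eq0.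
pose G d : fps m := \sum_(k < d.+1) f ^+ k.
have GE d mu : (mdeg mu <= d)%N -> G d mu = G (mdeg mu) mu.
  elim: d => [|d IHd]; first by rewrite leqn0 => /eqP ->.
  rewrite leq_eqVlt => /predU1P[-> //|lt_d]; rewrite -IHd //.
  by rewrite /G big_ord_recr -[LHS]/(_ + _) /= fX // addr0.
apply/unitrP; exists (fun mu => G (mdeg mu) mu); rewrite mulrC.
suff -> : (1 - f) * (fun mu => G (mdeg mu) mu) = 1 by [].
apply/funext => mu; transitivity (((1 - f) * G (mdeg mu)) mu).
  by rewrite !fps_mulE; apply: eq_bigr => k _; rewrite -(GE (mdeg mu)) // mdegB.
rewrite /G -opprB mulNr -subrX1 opprB -[LHS]/(_ - _) fX ?subr0 //.
Qed.

(* The sum of a locally finite family; a coefficient to which infinitely many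
   terms contribute is set to 0. *)
Definition fps_sum (F : nat -> fps m) : fps m :=
  fun mu => \sum_(i \in [set: nat]) F i mu.

(* [zvar k] is the variable [z_k], for [1 <= k <= m]. *)
Definition zvar (k : nat) : fps m :=
  fps_mon [multinom nat_of_bool (i.+1 == k) | i < m].

End FpsRing.

Arguments zvar : clear implicits.

(* The inclusion of [Z[[z_1, ..., z_k]]] in [Z[[z_1, ..., z_m]]], for
   [k <= m]. *)
Definition fps_widen k m (f : fps k) : fps m := fun mu =>
  if [forall j : 'I_m, (k <= j)%N ==> (mu j == 0%N)]
  then f [multinom nth 0%N mu i | i < k] else 0.

Arguments fps_widen {k} m f.

Lemma fps_sum_lastE n (w : nat -> fps n) mu :
  fps_sum (fun i => fps_widen n.+1 (w i) * zvar n.+1 n.+1 ^+ i) mu =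
  w (mu ord_max) [multinom nth 0%N mu i | i < n].
Proof.
pose a : 'X_{1..n.+1} := [multinom nat_of_bool (i.+1 == n.+1) | i < n.+1].
have aE i j : (a *+ i)%MM j = if j == ord_max then i else 0%N.
  by rewrite mulmnE mnmE eqSS -[(j == n :> nat)]/(j == ord_max); case: eqP;
    rewrite ?mul1n ?mul0n.
have termE i : (fps_widen n.+1 (w i) * zvar n.+1 n.+1 ^+ i) mu =
    if i == mu ord_max then w i [multinom nth 0%N mu i | i < n] else 0.
  rewrite fps_monX fps_mulXE -/a.
  case: ifPn => [/mnm_lepP le_a|]; last first.
    case: eqP => // -> /mnm_lepP []; move=> j; rewrite aE.
    by case: eqP => // ->.
  rewrite /fps_widen; have -> : [forall j : 'I_n.+1, (n <= j)%N ==>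
      ((mu - a *+ i)%MM j == 0%N)] = (i == mu ord_max).
    have le_i := le_a ord_max; rewrite aE eqxx in le_i.
    apply/forallP/eqP => [/(_ ord_max)|-> j].
      rewrite leqnn /= mnmBE aE eqxx subn_eq0 => ?.
      by apply/eqP; rewrite eqn_leq le_i.
    apply/implyP => le_j; have -> : j = ord_max.
      by apply/val_inj/eqP; rewrite eqn_leq le_j -ltnS ltn_ord.
    by rewrite mnmBE aE eqxx subnn.
  case: eqP => // _; congr (w i _); apply/mnmP => j; rewrite !mnmE.
  have lt_j : (j < n.+1)%N by rewrite ltnW // ltnS.
  rewrite -!(mnm_nth 0%N _ (Ordinal lt_j)) mnmBE aE.
  by rewrite -val_eqE /= ltn_eqF // subn0.
rewrite /fps_sum (eq_fsbigr
  (fun i => if i == mu ord_max then w i [multinom nth 0%N mu i | i < n] else 0)).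
  rewrite -(@fsbig_widen _ _ _ _ [set mu ord_max]) ?fsbig_set1 ?eqxx //.
  by move=> i [_ /eqP/negPf] /= ->.
by move=> i _; exact: termE.
Qed.

(* Every power series in [z_1, ..., z_n] is uniquely [sum_i w_i z_n^i] with
   [w_i] a power series in [z_1, ..., z_(n-1)]. *)
Lemma fps_expand_last n (f : fps n) : (0 < n)%N ->
  exists! w : nat -> fps n.-1,
    f = fps_sum (fun i => fps_widen n (w i) * zvar n n ^+ i).
Proof.
case: n f => // n f _ /=.
have nthE (mu : 'X_{1..n}) i (j : 'I_n.+1) :
    ([multinom nth i mu j | j < n.+1])%MM j = nth i mu j by rewrite mnmE.
exists (fun i mu => f [multinom nth i mu j | j < n.+1]); split.
  apply/funext => mu; rewrite fps_sum_lastE; congr f; apply/mnmP => j.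
  rewrite nthE; have [lt_j|le_j] := ltnP j n.
    rewrite (set_nth_default 0%N) ?size_tuple //.
    by rewrite -(mnm_nth 0%N _ (Ordinal lt_j)) mnmE /= -mnm_nth.
  rewrite nth_default ?size_tuple //; congr (mu _); apply/val_inj/eqP.
  by rewrite eqn_leq le_j -ltnS ltn_ord.
move=> w ->; apply/funext => i; apply/funext => mu; rewrite fps_sum_lastE.
rewrite nthE nth_default ?size_tuple //; congr (w i _); apply/mnmP => j.
have lt_j : (j < n.+1)%N by rewrite ltnW // ltnS.
by rewrite mnmE -(mnm_nth 0%N _ (Ordinal lt_j)) nthE (mnm_nth i).
Qed.

(** * Dimension of subspaces of a possibly infinite-dimensional space *)

Definition has_dim (K : fieldType) (V : lmodType K) (S : set V) (d : nat) :=
  exists b : 'I_d -> V,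
    (forall c : 'I_d -> K, \sum_i c i *: b i = 0 -> forall i, c i = 0) /\
    S = [set \sum_i c i *: b i | c in [set: 'I_d -> K]].

(* Zero when [S] is not a finite-dimensional subspace. *)
Definition dim (K : fieldType) (V : lmodType K) (S : set V) : nat :=
  xget 0%N (has_dim S).

(** * Zariski closure in affine space *)

Section Zariski.
Context (K : fieldType) (N : nat).

Definition zero_locus (P : set {mpoly K[N]}) : set ('I_N -> K) :=
  [set v | forall p, P p -> p.@[v] = 0].

Definition zariski_closed (Z : set ('I_N -> K)) :=
  exists P, Z = zero_locus P.

Definition zariski_closure (A : set ('I_N -> K)) : set ('I_N -> K) :=
  smallest zariski_closed A.

Definition vanishing_ideal (A : set ('I_N -> K)) : {mpoly K[N]} -> bool :=
  fun p => `[< forall v, A v -> p.@[v] = 0 >].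

End Zariski.

(** * The trees *)

(* The vertices are the numbers less than [nb_vertices]; [edges] lists the end
   points of the edges, and [leaves] the vertices that are leaves, both in the
   order of their numbering. *)
Record numbered_tree := NumberedTree {
  nb_vertices : nat;
  edges : seq (nat * nat);
  leaves : seq nat }.

Definition tripod : numbered_tree :=
  NumberedTree 4 [:: (0, 1); (0, 2); (0, 3)]%N [:: 1; 2; 3]%N.

Definition attach_cherry (T : numbered_tree) : numbered_tree :=
  let v := last 0%N (leaves T) in
  let a := nb_vertices T in
  let b := (nb_vertices T).+1 in
  NumberedTree (nb_vertices T).+2
    (edges T ++ [:: (v, a); (v, b)])
    (take (size (leaves T)).-1 (leaves T) ++ [:: a; b]).

(* Meaningful for [3 <= n] only. *)
Definition Tree (n : nat) : numbered_tree := iter (n - 3) attach_cherry tripod.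

Lemma size_leaves_Tree n : (3 <= n)%N -> size (leaves (Tree n)) = n.
Proof.
move=> /subnK {2}<-; rewrite /Tree; elim: (n - 3)%N => //= k IHk.
by rewrite size_cat size_take IHk addn3 /= leqnn addn2 addn3.
Qed.

Lemma size_edges_Tree n : (3 <= n)%N -> size (edges (Tree n)) = (2 * n - 3)%N.
Proof.
move=> /subnK {2}<-; rewrite /Tree; elim: (n - 3)%N => //= k IHk.
rewrite size_cat IHk /= !mulnDr -!addnBA //.
by rewrite [(2 * k.+1)%N]mulnS addnC addnA.
Qed.

Definition adjacent (T : numbered_tree) : rel nat :=
  fun u v => ((u, v) \in edges T) || ((v, u) \in edges T).

(* [p] is the list of the vertices that follow [u] on the path. *)
Definition simple_path (T : numbered_tree) (u v : nat) (p : seq nat) :=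
  [/\ path (adjacent T) u p, last u p = v & uniq (u :: p)].

Definition traverses (u : nat) (p : seq nat) (e : nat * nat) : bool :=
  (e \in zip (u :: p) p) || ((e.2, e.1) \in zip (u :: p) p).

(* [edge_between T i j e] means that edge number [e] is on the path joining leaf
   number [i] to leaf number [j], all numbers starting from 0. *)
Definition edge_between (T : numbered_tree) (i j e : nat) : Prop :=
  let u := nth 0%N (leaves T) i in
  let v := nth 0%N (leaves T) j in
  exists2 p, simple_path T u v p & traverses u p (nth (0, 0)%N (edges T) e).

Definition path_vector n (i j : 'I_n) : 'rV[int]_(2 * n - 3) :=
  \row_e (`[< edge_between (Tree n) i j e >] : nat)%:Z.

(** * The variety, its coordinate ring, and the Hilbert series *)

Definition leaf_pair (n : nat) := {p : 'I_n * 'I_n | (p.1 < p.2)%N}.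

(* The coordinates [x_(i,j)] are numbered by enumerating the pairs [i < j]. *)
Definition nvars (n : nat) : nat := #|{: leaf_pair n}|.

Definition fst_leaf n (k : 'I_(nvars n)) : 'I_n := (val (enum_val k)).1.
Definition snd_leaf n (k : 'I_(nvars n)) : 'I_n := (val (enum_val k)).2.

Section Variety.
Context (R : realType) (n : nat).
Local Notation C := R[i].
Local Notation N := (nvars n).

Definition torus : set ('I_(2 * n - 3) -> C) := [set t | forall e, t e != 0].

Definition monomial_map (t : 'I_(2 * n - 3) -> C) : 'I_N -> C := fun k =>
  \prod_e t e ^ (path_vector (fst_leaf k) (snd_leaf k) ord0 e).

Definition X_aff : set ('I_N -> C) := zariski_closure (monomial_map @` torus).

Definition X_ideal : {mpoly C[N]} -> bool := vanishing_ideal X_aff.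

Let X_ideal_closed : idealr_closed X_ideal.
Proof.
split.
- by apply/asboolP => v _; rewrite meval0.
- apply/negP => /asboolP /(_ (monomial_map (fun=> 1))) mono0.
  have /mono0 /eqP : X_aff (monomial_map (fun=> 1)).
    apply: (sub_gen_smallest (G := monomial_map @` torus)).
    by exists (fun=> 1) => // e; rewrite oner_neq0.
  by rewrite meval1 oner_eq0.
- move=> a p q /asboolP p0 /asboolP q0; apply/asboolP => v Xv.
  by rewrite mevalD mevalM p0 // q0 // mulr0 addr0.
Qed.

HB.instance Definition _ := isIdealr.Build {mpoly C[N]} X_ideal X_ideal_closed.

Definition X_idealr : idealr {mpoly C[N]} := X_ideal.

Definition coord_ring : Type := {ideal_quot X_idealr}.

HB.instance Definition _ := GRing.ComNzRing.on coord_ring.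

Definition class_of (p : {mpoly C[N]}) : coord_ring :=
  \pi_({ideal_quot X_idealr})%qT p.

Let class_ofD p q : class_of (p + q) = class_of p + class_of q.
Proof. exact: rmorphD. Qed.

Let class_ofM p q : class_of (p * q) = class_of p * class_of q.
Proof. exact: rmorphM. Qed.

Let class_of1 : class_of 1 = 1.
Proof. exact: rmorph1. Qed.

Definition coord_scale (c : C) (x : coord_ring) : coord_ring :=
  class_of c%:MP * x.

Let coord_scaleA c d x : coord_scale c (coord_scale d x) = coord_scale (c * d) x.
Proof. by rewrite /coord_scale mulrA -class_ofM -mpolyCM. Qed.

Let coord_scale1 : left_id 1 coord_scale.
Proof. by move=> x; rewrite /coord_scale class_of1 mul1r. Qed.

Let coord_scaleDr : right_distributive coord_scale +%R.
Proof. by move=> c x y; rewrite /coord_scale mulrDr. Qed.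

Let coord_scaleDl x : {morph coord_scale^~ x : c d / c + d}.
Proof. by move=> c d; rewrite /coord_scale mpolyCD class_ofD mulrDl. Qed.

HB.instance Definition _ := GRing.Zmodule_isLmodule.Build C coord_ring
  coord_scaleA coord_scale1 coord_scaleDr coord_scaleDl.

Lemma class_ofZ c p : class_of (c *: p) = c *: class_of p.
Proof. by rewrite -mul_mpolyC class_ofM. Qed.

Definition var_degree (k : 'I_N) : 'rV[int]_n :=
  delta_mx ord0 (fst_leaf k) + delta_mx ord0 (snd_leaf k).

Definition mono_degree (m : 'X_{1..N}) : 'rV[int]_n :=
  \sum_k var_degree k *+ m k.

Definition homogeneous (lambda : 'rV[int]_n) (p : {mpoly C[N]}) :=
  forall m, m \in msupp p -> mono_degree m = lambda.

Definition graded_piece (lambda : 'rV[int]_n) : set coord_ring :=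
  class_of @` homogeneous lambda.

Definition hilbert_series : fps n := fun mu =>
  (dim (graded_piece (\row_i (mu i)%:Z)))%:Z.

(* The pieces whose degree has a negative entry, which [hilbert_series] leaves
   out, do not contribute to the sum over all degrees in [Z^n]. *)
Lemma dim_graded_piece_neg (lambda : 'rV[int]_n) (i : 'I_n) :
  lambda ord0 i < 0 -> dim (graded_piece lambda) = 0%N.
Proof.
move=> neg; have -> : graded_piece lambda = [set 0].
  apply/seteqP; split => [_ [p hp <-]|_ ->] /=.
    suff -> : p = 0 by exact: rmorph0.
    apply/eqP; rewrite -msupp_eq0; case E : (msupp p) => [//|m s].
    have /hp deg_m : m \in msupp p by rewrite E mem_head.
    move: neg; rewrite -deg_m /mono_degree summxE ltNge sumr_ge0 // => k _.
    rewrite mulmxnE mulrn_wge0 // !mxE.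
    by rewrite addr_ge0 // ler0n.
  by exists 0; [move=> m; rewrite msupp0 | exact: rmorph0].
apply: xget_unique => [|[//|d] [b [free_b b0]]].
  exists (fun=> 0); split => [c _ [] //|]; apply/seteqP; split => [_ ->|_ [c _ <-]].
    by exists (fun=> 0) => //; rewrite big_ord0.
  by rewrite big_ord0.
have sum_b : \sum_i (i == ord0)%:R *: b i = b ord0.
  rewrite (bigD1 ord0) //= scale1r big1 ?addr0 // => j /negPf ->.
  by rewrite scale0r.
have b_ord0 : b ord0 = 0.
  have : [set \sum_i c i *: b i | c in [set: 'I_d.+1 -> C]] (b ord0).
    by exists (fun i => (i == ord0)%:R).
  by rewrite -b0.
have := free_b _ (etrans sum_b b_ord0) ord0.
by rewrite eqxx => /eqP; rewrite oner_eq0.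
Qed.

End Variety.

Arguments hilbert_series : clear implicits.

(* Main.v *)
(* A point of the semigroup is a list of leaf pairs, up to equality of the
   resulting weights on the edges.  Monomials with the same weights agree on the
   torus and those with distinct weights are independent there, so the
   coefficient of [z^mu] in [W_n] counts the weights of multidegree [mu].

   Let [p] and [q] be the degrees at the two leaves of the last cherry of
   [T_(n+1)].  Weights of a list using the path between these two leaves are
   exactly the translates by that path of weights of degrees [p - 1] and [q - 1].
   A list not using it merges into a list for [T_n] of degree [p + q] at the last
   leaf, and every such list splits back.  The value on the edge below the cherry
   is [p + q] in the second case and smaller in the first, so the two cases are
   disjoint, whence
     [W_(n+1)(.., p, q) = W_n(.., p + q) + W_(n+1)(.., p - 1, q - 1)]. *)
Require Import Defs.
From mathcomp Require Import all_boot all_order all_algebra.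
From mathcomp Require Import ring_quotient complex mpoly.
From mathcomp Require Import boolp classical_sets fsbigop reals zify.

Set Implicit Arguments.
Unset Strict Implicit.
Unset Printing Implicit Defensive.

Import Order.TTheory GRing.Theory Num.Theory.

(** * Paths in trees *)

Lemma adjacentC T u v : adjacent T u v = adjacent T v u.
Proof. exact: orbC. Qed.

Lemma traverses_mem u p e : traverses u p e -> e.2 \in u :: p.
Proof.
case: e => x y; rewrite /traverses /= => /orP[] xy; last first.
  have /(map_f fst) : (y, x) \in zip (u :: p) p by [].
  rewrite -/(unzip1 _) => /mem_subseq; apply; elim: p {xy} u => //= w p IHp u.
  by rewrite eqxx.
have /(map_f snd) : (x, y) \in zip (u :: p) p by [].
by rewrite -/(unzip2 _) unzip2_zip ?leqW //= in_cons => ->; rewrite orbT.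
Qed.

Lemma zip_path_rcons (S : Type) (u : S) p a :
  zip (u :: rcons p a) (rcons p a) = rcons (zip (u :: p) p) (last u p, a).
Proof. by elim: p u => //= w p IHp u; rewrite -IHp. Qed.

(** * Simple paths near a vertex with a single neighbour *)

Section PendantVertex.
Context (T : numbered_tree) (a x : nat).
Hypothesis pend : forall w, adjacent T w a -> w = x.

(** An inner occurrence of [a] would be preceded and followed by neighbours of [a]. Both would be
    [x], so the path would repeat a vertex. *)
Lemma pendant_notin u t p :
  simple_path T u t p -> a != u -> a != t -> a \notin u :: p.
Proof.
case=> pp <- up ne_u ne_t; rewrite inE (negPf ne_u) /=; apply/negP => ap.
case/splitPr: ap pp up ne_t => p1 p2; rewrite cat_path /=.
case/and3P=> _ /pend v1; rewrite last_cat /=; case: p2 => [|y p2] /=.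
  by rewrite eqxx.
rewrite adjacentC => /andP[/pend -> _] /andP[] + + _.
rewrite cat_uniq => nu /and3P[_ /hasPn up _].
have := mem_last u p1; rewrite v1 inE => /predU1P[Ex|x1]; last first.
  by move: up => /(_ x); rewrite !inE eqxx orbT x1 => /(_ isT).
by move: nu; rewrite mem_cat !inE Ex eqxx !orbT.
Qed.

Lemma simple_path_to_pendant u p :
  simple_path T u a p -> a != u ->
  exists2 p', p = rcons p' a & simple_path T u x p'.
Proof.
case; case/lastP: p => [|p b]; first by move=> _ /= -> _; rewrite eqxx.
rewrite last_rcons rcons_path -rcons_cons rcons_uniq.
move=> /andP[pp lp] Eb /andP[_ up] _; rewrite Eb in lp *; exists p => //.
by split=> //; apply: pend.
Qed.

(** A path starting or ending at [a] has [x] next to it, and any other simple path avoids [a]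
    altogether. *)
Lemma traverses_pendant u t p : simple_path T u t p -> u != t ->
  traverses u p (x, a) = (u == a) || (t == a).
Proof.
move=> sp ne_ut; have [Eu|ne_u] := eqVneq u a.
  case: sp ne_ut => + + _; rewrite Eu.
  case: p => [/= _ ->|y p /= + _ _]; first by rewrite eqxx.
  by rewrite adjacentC => /andP[/pend -> _]; rewrite /traverses !inE eqxx orbT.
rewrite eq_sym in ne_u; have [Et|ne_t] := eqVneq t a; last first.
  apply/negP => /traverses_mem /=; rewrite eq_sym in ne_t.
  by rewrite (negPf (pendant_notin sp ne_u ne_t)).
rewrite Et in sp; have [p' -> [_ <- _]] := simple_path_to_pendant sp ne_u.
by rewrite /traverses zip_path_rcons mem_rcons mem_head.
Qed.

End PendantVertex.

(** The invariant kept when a cherry is attached. Its last clause says that the last leaf has one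
    neighbour [x] and that the last edge, number [2 * n - 4] from 0, is listed as running from [x]
    to that leaf. *)
Record well_formed (T : numbered_tree) (n : nat) : Prop := WellFormed {
  wf_size_leaves : size (leaves T) = n;
  wf_size_edges : size (edges T) = (2 * n - 3)%N;
  wf_edges : forall e, e \in edges T ->
    (e.1 < nb_vertices T)%N /\ (e.2 < nb_vertices T)%N;
  wf_leaves : forall v, v \in leaves T -> (v < nb_vertices T)%N;
  wf_uniq : uniq (leaves T);
  wf_connected : forall i j, (i < j < n)%N ->
    exists p, simple_path T (nth 0 (leaves T) i)%N (nth 0 (leaves T) j)%N p;
  wf_pendant : exists2 x, forall w, adjacent T w (last 0 (leaves T))%N -> w = x
    & nth (0, 0)%N (edges T) (2 * n - 4) = (x, last 0 (leaves T))%N }.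

Lemma well_formed_tripod : well_formed tripod 3.
Proof.
split=> //.
- by move=> e; rewrite !inE => /or3P[] /eqP ->.
- by move=> e; rewrite !inE => /or3P[] /eqP ->.
- move=> i j /=; case: i => [|[|[|i]]]; case: j => [|[|[|j]]] //= ij.
  + by exists [:: 0; 2]%N.
  + by exists [:: 0; 3]%N.
  + by exists [:: 0; 3]%N.
  + by exfalso; lia.
- exists 0%N => // w; rewrite /adjacent !inE !xpair_eqE /= !andbF !orbF /=.
  by move=> /andP[/eqP].
Qed.

(** * Paths after a cherry is attached at the last leaf *)

Section Cherry.
Context (T : numbered_tree) (n : nat).
Hypotheses (n_gt1 : (1 < n)%N) (wfT : well_formed T n).
Local Notation T' := (attach_cherry T).
Local Notation v := (last 0%N (leaves T)).
Local Notation a := (nb_vertices T).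
Local Notation b := (nb_vertices T).+1.
Local Notation leaf T := (nth 0%N (leaves T)).

Let size_leavesT : size (leaves T) = n := wf_size_leaves wfT.

Let leafv : v = leaf T n.-1.
Proof. by rewrite -size_leavesT nth_last. Qed.

Let leaf_lt i : (i < n)%N -> (leaf T i < a)%N.
Proof. by move=> lt_i; rewrite (wf_leaves wfT) // mem_nth // size_leavesT. Qed.

Let lt_va : (v < a)%N.
Proof. by rewrite leafv leaf_lt // ltn_predL ltnW. Qed.

Lemma leaf_cherry i : leaf T' i =
  if (i < n.-1)%N then leaf T i else if i == n.-1 then a else
  if i == n then b else 0%N.
Proof.
rewrite /= size_leavesT nth_cat size_take size_leavesT ltn_predL.
have -> : (0 < n)%N by exact: ltnW.
case: ltnP => [lt_i|]; first by rewrite nth_take.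
rewrite leq_eqVlt => /predU1P[<-|lt_i]; first by rewrite subnn eqxx.
rewrite gtn_eqF //; have [->|ne_i] := eqVneq i n.
  by rewrite -{1}(prednK (ltnW n_gt1)) subSnn.
by rewrite nth_default //=; lia.
Qed.

Lemma size_edges_cherry : size (edges T') = (2 * n - 1)%N.
Proof. rewrite size_cat (wf_size_edges wfT) /=; lia. Qed.

Let adj_old u w : (u < a)%N -> (w < a)%N -> adjacent T' u w = adjacent T u w.
Proof.
move=> lt_u lt_w; rewrite /adjacent !mem_cat !inE !xpair_eqE.
by rewrite !(ltn_eqF lt_w, ltn_eqF lt_u, ltn_eqF (leqW lt_u), ltn_eqF (leqW lt_w))
  !andbF !orbF.
Qed.

Let adj_sub u w : adjacent T u w -> adjacent T' u w.
Proof. by rewrite /adjacent !mem_cat => /orP[] ->; rewrite ?orbT. Qed.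

Let adj_lt u w : adjacent T u w -> (w < a)%N.
Proof. by case/orP => /(wf_edges wfT) []. Qed.

Let pend_a w : adjacent T' w a -> w = v.
Proof.
rewrite /adjacent !mem_cat !inE !xpair_eqE -orbACA.
rewrite -[X in X || _]/(adjacent T w a) => /orP[/adj_lt|]; first by rewrite ltnn.
by rewrite eqxx (gtn_eqF lt_va) (ltn_eqF (ltnSn a)) !andbF !orbF andbT => /eqP.
Qed.

Let pend_b w : adjacent T' w b -> w = v.
Proof.
rewrite /adjacent !mem_cat !inE !xpair_eqE -orbACA.
rewrite -[X in X || _]/(adjacent T w b) => /orP[/adj_lt|].
  by rewrite ltnNge leqnSn.
by rewrite eqxx (gtn_eqF (leqW lt_va)) (gtn_eqF (ltnSn a)) !andbF !orbF andbT => /eqP.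
Qed.

Let adj_va : adjacent T' v a.
Proof. by rewrite /adjacent !mem_cat !inE eqxx !orbT. Qed.

Let adj_vb : adjacent T' v b.
Proof. by rewrite /adjacent !mem_cat !inE eqxx !orbT. Qed.

(** Both new vertices have [v] as their only neighbour, so a simple path between old vertices avoids
    them and uses old edges only. *)
Let simple_path_old u t p : (u < a)%N -> (t < a)%N ->
  simple_path T' u t p <-> simple_path T u t p.
Proof.
move=> lt_u lt_t; split=> [sp|[pp lp up]]; last first.
  by split=> //; apply: sub_path pp.
have na : a \notin u :: p by apply: (pendant_notin pend_a sp); rewrite gtn_eqF.
have nb : b \notin u :: p.
  by apply: (pendant_notin pend_b sp); rewrite gtn_eqF // ltnW.
case: sp => pp lp up; split=> //; elim: p u lt_u na nb pp {lp up} => //= w p IHp u lt_u.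
rewrite !inE !negb_or => /and3P[_ ne_a na] /and3P[_ ne_b nb] /andP[uw pp].
have lt_w : (w < a)%N.
  move: uw; rewrite /adjacent !mem_cat -orbACA -[X in X || _]/(adjacent T u w).
  case/orP => [/adj_lt //|].
  rewrite !inE !xpair_eqE ![w == _]eq_sym (negPf ne_a) (negPf ne_b).
  by rewrite !(ltn_eqF lt_u, ltn_eqF (leqW lt_u)) !andbF.
by rewrite -(adj_old lt_u lt_w) uw IHp // inE negb_or ?ne_a ?ne_b.
Qed.

(** The last step into a new leaf must come from [v]; what precedes it is a path between old
    vertices. *)
Let simple_path_new u c p : (u < a)%N -> c \in [:: a; b] ->
  simple_path T' u c p <-> exists2 p', p = rcons p' c & simple_path T u v p'.
Proof.
move=> lt_u cab; have lt_uc : (u < c)%N.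
  by move: cab; rewrite !inE => /orP[] /eqP -> //; apply: ltnW.
have pend_c w : adjacent T' w c -> w = v.
  by move: cab; rewrite !inE => /orP[] /eqP ->; [apply: pend_a|apply: pend_b].
have adj_c : adjacent T' v c by move: cab; rewrite !inE => /orP[] /eqP ->.
have lt_vc : (v < c)%N.
  by move: cab; rewrite !inE => /orP[] /eqP -> //; apply: ltnW.
split=> [sp|[p' -> sp]].
  have ne_cu : c != u by rewrite gtn_eqF.
  have [p' -> sp'] := simple_path_to_pendant pend_c sp ne_cu.
  by exists p' => //; apply/simple_path_old.
have sp' : simple_path T' u v p' by apply/(simple_path_old _ lt_u lt_va).
case: (sp') => pp lp up.
split; rewrite ?last_rcons // ?rcons_path ?pp ?lp //.
rewrite -rcons_cons rcons_uniq up andbT.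
by apply: (pendant_notin pend_c sp'); rewrite gtn_eqF.
Qed.

Let simple_path_ab p : simple_path T' a b p <-> p = [:: v; b].
Proof.
split=> [sp|->]; last first.
  split; rewrite //= ?adj_vb ?andbT ?[adjacent _ a _]adjacentC ?adj_va //.
  by rewrite !inE gtn_eqF // ltn_eqF // ltn_eqF // ltnW.
have ne_ba : b != a by rewrite gtn_eqF.
have [p' -> [+ + +]] := simple_path_to_pendant pend_b sp ne_ba.
case: p' => [/= _ Ea|y p' /=]; first by move: lt_va; rewrite -Ea ltnn.
rewrite adjacentC => /andP[/pend_a -> _]; case: p' => //= z p'.
by move=> Ez /and3P[_ + _]; rewrite -{1}Ez mem_last.
Qed.

Lemma well_formed_cherry : well_formed T' n.+1.
Proof.
split.
- by rewrite /= size_cat size_take size_leavesT ltn_predL ltnW //=; lia.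
- by rewrite size_edges_cherry; lia.
- move=> e; rewrite mem_cat !inE => /orP[/(wf_edges wfT)|/orP[]/eqP ->] /=; lia.
- move=> l; rewrite mem_cat !inE => /orP[/mem_take/(wf_leaves wfT)|/orP[]/eqP->] /=; lia.
- rewrite /= cat_uniq take_uniq ?(wf_uniq wfT) //= !inE.
  rewrite (ltn_eqF (ltnSn a)) !orbF !andbT; apply/norP.
  by split; apply/negP => /mem_take/(wf_leaves wfT); lia.
- move=> i j /andP[lt_ij lt_j]; rewrite !leaf_cherry.
  have [lt_in|le_in] := ltnP i n.-1; last first.
    have [-> ->] : i = n.-1 /\ j = n by lia.
    exists [:: v; b]; rewrite ltnNge leq_pred /= eqxx.
    by rewrite gtn_eqF ?ltn_predL ?(ltnW n_gt1) // eqxx; apply/simple_path_ab.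
  have lt_i : (leaf T i < a)%N by apply: leaf_lt; lia.
  have [lt_jn|le_jn] := ltnP j n.-1.
    have [|p sp] := wf_connected wfT (i := i) (j := j); first by lia.
    by exists p; apply/simple_path_old => //; apply: leaf_lt; lia.
  have [|p sp] := wf_connected wfT (i := i) (j := n.-1); first by lia.
  rewrite -leafv in sp.
  case: (eqVneq j n.-1) => [_|ne_j].
    by exists (rcons p a); apply/simple_path_new => //; rewrite ?inE ?eqxx ?orbT //; exists p.
  have -> : j == n by lia.
  by exists (rcons p b); apply/simple_path_new => //; rewrite ?inE ?eqxx ?orbT //; exists p.
- exists v; rewrite /= last_cat /=; first exact: pend_b.
  have -> : (2 * n.+1 - 4 = (2 * n - 3).+1)%N by lia.
  by rewrite nth_cat (wf_size_edges wfT) ltnNge leqnSn subSnn.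
Qed.

Let traverses_old u p c e : e \in edges T -> (a <= c)%N ->
  traverses u (rcons p c) e = traverses u p e.
Proof.
case: e => x y /(wf_edges wfT) /= [lt_x lt_y] le_c.
rewrite /traverses zip_path_rcons !mem_rcons !inE /= !xpair_eqE.
by rewrite [y == c]ltn_eqF ?[x == c]ltn_eqF ?(leq_trans _ le_c) // !andbF.
Qed.

(** Both new leaves, numbers [n.-1] and [n], hang from the old last leaf [v], so on the old edges a
    path to either looks like the path to [v], whence [minn j n.-1]. For [i = n.-1] the path runs
    inside the cherry and meets no old edge. *)
Lemma edge_between_cherry i j e : (i < j <= n)%N -> (e < 2 * n - 3)%N ->
  edge_between T' i j e <-> (i < n.-1)%N /\ edge_between T i (minn j n.-1) e.
Proof.
move=> /andP[lt_ij le_j] lt_e; rewrite /edge_between !leaf_cherry.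
have -> : nth (0, 0)%N (edges T') e = nth (0, 0)%N (edges T) e.
  by rewrite nth_cat (wf_size_edges wfT) lt_e.
have : nth (0, 0)%N (edges T) e \in edges T by rewrite mem_nth ?(wf_size_edges wfT).
move: (nth _ _ e) => {lt_e}e e_in.
have [lt_in|le_in] := ltnP i n.-1; last first.
  have [-> ->] : i = n.-1 /\ j = n by lia.
  rewrite eqxx ltnNge leq_pred /= gtn_eqF ?ltn_predL ?(ltnW n_gt1) // eqxx.
  split=> [[p /simple_path_ab ->]|[//]].
  have [lt_1 lt_2] := wf_edges wfT e_in.
  case: e e_in lt_1 lt_2 => x y _ /= lt_x lt_y.
  rewrite /traverses !inE /= !xpair_eqE.
  by rewrite !(ltn_eqF lt_x) !(ltn_eqF lt_y) !(ltn_eqF (leqW lt_x)) ?(ltn_eqF (leqW lt_y)) !andbF.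
have lt_i : (leaf T i < a)%N by apply: leaf_lt; lia.
have [lt_jn|le_jn] := ltnP j n.-1.
  have lt_lj : (leaf T j < a)%N by apply: leaf_lt; lia.
  by split=> [[p /simple_path_old sp tp]|[_ [p /simple_path_old sp tp]]];
    [split=> //|]; exists p => //; apply: sp.
rewrite -leafv.
suff H c : c \in [:: a; b] -> (exists2 p, simple_path T' (leaf T i) c p &
    traverses (leaf T i) p e) <-> exists2 p, simple_path T (leaf T i) v p &
    traverses (leaf T i) p e.
  case: (eqVneq j n.-1) => [_|ne_j].
    by rewrite H ?inE ?eqxx ?orbT //; split=> [|[]].
  have -> : j == n by lia.
  by rewrite H ?inE ?eqxx ?orbT //; split=> [|[]].
move=> cab; have le_c : (a <= c)%N by move: cab; rewrite !inE => /orP[] /eqP ->.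
split=> [[p /(simple_path_new _ lt_i cab) [p' -> sp]]|[p sp tp]].
  by rewrite traverses_old //; exists p'.
exists (rcons p c); last by rewrite traverses_old.
by apply/simple_path_new => //; exists p.
Qed.

(** Edge [2 * n - 3] is [(v, a)], the pendant edge of leaf number [n.-1]. *)
Lemma edge_between_cherry_new i j : (i < j <= n)%N ->
  edge_between T' i j (2 * n - 3) <-> (i == n.-1) || (j == n.-1).
Proof.
(* The path [p] is the witness for the converse direction, where some path must be exhibited. *)
move=> ij; have wfT' := well_formed_cherry; have [|p sp] := wf_connected wfT' (i := i) (j := j).
  by rewrite ltnS.
have lt_j : (j < size (leaves T'))%N by rewrite (wf_size_leaves wfT'); lia.
have lt_i : (i < size (leaves T'))%N by rewrite (wf_size_leaves wfT'); lia.
have lt_n : (n.-1 < size (leaves T'))%N by rewrite (wf_size_leaves wfT'); lia.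
have ne_ij : leaf T' i != leaf T' j.
  by rewrite nth_uniq // ?(wf_uniq wfT'); lia.
have leaf_a : a = leaf T' n.-1 by rewrite leaf_cherry ltnn eqxx.
rewrite /edge_between.
have -> : nth (0, 0)%N (edges T') (2 * n - 3) = (v, a).
  by rewrite nth_cat (wf_size_edges wfT) ltnn subnn.
have trE q : simple_path T' (leaf T' i) (leaf T' j) q ->
    traverses (leaf T' i) q (v, a) = (i == n.-1) || (j == n.-1).
  move=> sq; rewrite (traverses_pendant pend_a sq) //.
  by rewrite {1 2}leaf_a !nth_uniq // (wf_uniq wfT').
by split=> [[q sq]|ijn]; [rewrite trE|exists p; rewrite ?trE].
Qed.

End Cherry.

Lemma well_formed_Tree n : (3 <= n)%N -> well_formed (Tree n) n.
Proof.
move=> /subnK {2}<-; rewrite /Tree; elim: (n - 3)%N => [|k IHk].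
  exact: well_formed_tripod.
by rewrite iterS addSn; apply: well_formed_cherry IHk; lia.
Qed.

Lemma TreeS n : (3 <= n)%N -> Tree n.+1 = attach_cherry (Tree n).
Proof. by move=> n_ge3; rewrite /Tree subSn. Qed.

(** * Which paths of the trees use a given edge *)

Definition on_path n (q : nat * nat) (e : nat) : bool :=
  `[< edge_between (Tree n) q.1 q.2 e >].

Lemma on_path_old n i j e : (3 <= n)%N -> (i < j <= n)%N -> (e < 2 * n - 3)%N ->
  on_path n.+1 (i, j) e = (i < n.-1)%N && on_path n (i, minn j n.-1) e.
Proof.
move=> n_ge3 ij lt_e; rewrite /on_path /= TreeS //.
have -> : (i < n.-1)%N = `[< i < n.-1 >]%N by rewrite asboolb.
rewrite -asbool_and; apply: asbool_equiv_eq.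
by apply: edge_between_cherry => //; [lia|exact: well_formed_Tree].
Qed.

Lemma on_path_new n i j : (3 <= n)%N -> (i < j <= n)%N ->
  on_path n.+1 (i, j) (2 * n - 3) = (i == n.-1) || (j == n.-1).
Proof.
move=> n_ge3 ij; rewrite /on_path /= TreeS // -[RHS]asboolb.
apply: asbool_equiv_eq; apply: edge_between_cherry_new => //; [lia|].
exact: well_formed_Tree.
Qed.

Lemma on_path_last n i j : (3 <= n)%N -> (i < j < n)%N ->
  on_path n (i, j) (2 * n - 4) = (j == n.-1).
Proof.
move=> n_ge3 /andP[lt_ij lt_j]; rewrite /on_path /= -[RHS]asboolb.
apply: asbool_equiv_eq; have wfT := well_formed_Tree n_ge3.
have [|p sp] := wf_connected wfT (i := i) (j := j); first by rewrite lt_ij.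
have [x pend edge_x] := wf_pendant wfT.
have szT := wf_size_leaves wfT.
have trE q : simple_path (Tree n) (nth 0 (leaves (Tree n)) i)%N
      (nth 0 (leaves (Tree n)) j)%N q ->
    traverses (nth 0 (leaves (Tree n)) i)%N q
      (nth (0, 0)%N (edges (Tree n)) (2 * n - 4)) = (j == n.-1).
  move=> sq; rewrite edge_x (traverses_pendant pend sq).
    by rewrite -nth_last szT !nth_uniq ?(wf_uniq wfT) ?szT //; lia.
  by rewrite nth_uniq ?(wf_uniq wfT) ?szT //; lia.
by split=> [[q sq]|jn]; [rewrite trE|exists p; rewrite ?trE].
Qed.

(** * Hilbert series and weights *)

Local Open Scope classical_set_scope.
Local Open Scope ring_scope.

(** Expand [b] in [b'] and [b'] back in [b]. Since [b] is free, the product of the two coefficient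
    matrices is the identity of size [d], which forces [d <= d']. *)
Lemma has_dim_leq (K : fieldType) (V : lmodType K) (S : set V) d d' :
  has_dim S d -> has_dim S d' -> (d <= d')%N.
Proof.
move=> [b [free_b Sb]] [b' [_ Sb']].
have mem_basis e (x : 'I_e -> V) i :
    [set \sum_i c i *: x i | c in [set: 'I_e -> K]] (x i).
  exists (fun j => (j == i)%:R) => //; rewrite (bigD1 i) //= eqxx scale1r.
  by rewrite big1 ?addr0 // => j /negPf ->; rewrite scale0r.
have /choice[A bA] i : exists c : 'I_d' -> K, b i = \sum_j c j *: b' j.
  by have := mem_basis _ b i; rewrite -Sb Sb' => -[c _ <-]; exists c.
have /choice[B bB] j : exists c : 'I_d -> K, b' j = \sum_i c i *: b i.
  by have := mem_basis _ b' j; rewrite -Sb' Sb => -[c _ <-]; exists c.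
apply: (@mulmx1_min _ _ _ (\matrix_(i, j) A i j) (\matrix_(j, i) B j i)).
apply/matrixP => i k; rewrite !mxE; apply/eqP; rewrite -subr_eq0; apply/eqP.
apply: (free_b (fun k => \sum_j (\matrix_(i, j) A i j) i j *
                          (\matrix_(j, i) B j i) j k - (i == k)%:R)).
under eq_bigr do rewrite scalerBl scaler_suml.
rewrite sumrB exchange_big /= [X in _ - X](bigD1 i) //= eqxx scale1r.
rewrite [X in _ - (_ + X)]big1 ?addr0; last first.
  by move=> j; rewrite eq_sym => /negPf ->; rewrite scale0r.
apply/eqP; rewrite subr_eq0 [X in _ == X]bA; apply/eqP/eq_bigr => j _.
rewrite [in RHS]bB scaler_sumr; apply: eq_bigr => l _.
by rewrite !mxE scalerA.
Qed.

Lemma dim_unique (K : fieldType) (V : lmodType K) (S : set V) d :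
  has_dim S d -> Defs.dim S = d.
Proof.
move=> Sd; apply: xget_unique => // d' Sd'.
by apply/eqP; rewrite eqn_leq !(@has_dim_leq _ _ S).
Qed.

(* Dedekind's argument for the independence of characters: multiplying [t] by a
   point at which two monomials differ eliminates one of them. *)
Lemma monomials_free (K : numFieldType) M (I : eqType) (v : I -> 'I_M -> nat)
    (s : seq I) (c : I -> K) :
  (forall i j, v i =1 v j -> i = j) -> uniq s ->
  (forall t, (forall e, t e != 0) ->
     \sum_(i <- s) c i * \prod_e t e ^+ v i e = 0) ->
  forall i, i \in s -> c i = 0.
Proof.
move=> v_inj; elim: s c => // i0 s IHs c /= /andP[i0_s uniq_s] sum0.
have cs0 j : j \in s -> c j = 0.
  move=> js; have [e ne_e] : exists e, v j e != v i0 e.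
    apply/existsP; apply: contraNT i0_s => /existsPn eq_v.
    by rewrite -(v_inj j i0) // => e; apply/eqP; rewrite -[_ == _]negbK.
  (* At this point a monomial takes the value 2 to its exponent at [e]; such powers differ for
     distinct exponents in characteristic zero. *)
  pose t0 e' : K := if e' == e then 2 else 1.
  have t0_neq0 e' : t0 e' != 0.
    by rewrite /t0; case: (e' == e); rewrite ?pnatr_eq0 ?oner_eq0.
  have t0E i : \prod_e t0 e ^+ v i e = 2 ^+ v i e.
    rewrite (bigD1 e) //= /t0 eqxx big1 ?mulr1 // => e' /negPf ->.
    by rewrite expr1n.
  have /eqP : c j * (2 ^+ v j e - 2 ^+ v i0 e) = 0.
    apply: (IHs (fun i => c i * (2 ^+ v i e - 2 ^+ v i0 e))) => // t t_neq0.
    have sum_tt0 : c i0 * (2 ^+ v i0 e * \prod_e t e ^+ v i0 e) +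
        \sum_(i <- s) c i * (2 ^+ v i e * \prod_e t e ^+ v i e) = 0.
      rewrite -[RHS](sum0 (fun e => t0 e * t e)) => [|e']; last by rewrite mulf_neq0.
      rewrite big_cons; congr (_ + _); last apply: eq_bigr => i _.
        by under [in RHS]eq_bigr do rewrite exprMn; rewrite big_split t0E.
      by under [in RHS]eq_bigr do rewrite exprMn; rewrite big_split t0E.
    (* The relation at [t0 * t] minus [2 ^+ v i0 e] times the relation at [t] has no [i0] term, so
       the induction hypothesis applies. *)
    have := sum0 t t_neq0; rewrite big_cons => sum_t.
    rewrite -[RHS](subrr 0) -[X in _ = _ - X](mulr0 (2 ^+ v i0 e)).
    rewrite -[X in _ = X - _]sum_tt0 -[X in _ = _ - _ * X]sum_t.
    rewrite mulrDr opprD addrACA [c i0 * (_ * _)]mulrCA subrr add0r.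
    rewrite mulr_sumr -sumrB.
    apply: eq_bigr => i _.
    by rewrite [2 ^+ v i0 e * _]mulrCA -mulrBr -mulrBl mulrA.
  rewrite mulf_eq0 => /orP[/eqP //|]; rewrite subr_eq0 => /eqP.
  move/eqP; rewrite -!natrX eqr_nat eqn_exp2l // => /eqP eq_e.
  by rewrite eq_e eqxx in ne_e.
move=> i; rewrite inE => /predU1P[->|]; last exact: cs0.
have := sum0 (fun=> 1) (fun=> oner_neq0 _); rewrite big_cons big_seq.
have one t : \prod_(e < M) (1 : K) ^+ v t e = 1 by rewrite big1 // => e _; rewrite expr1n.
rewrite one mulr1 big1 ?addr0 // => j js.
by rewrite cs0 ?mul0r.
Qed.

(** * Lists of leaf pairs, their weights, and monomials *)

Definition leaf_degree (L : seq (nat * nat)) (i : nat) : nat :=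
  \sum_(q <- L) ((q.1 == i) + (q.2 == i)).

Definition edge_weights n (L : seq (nat * nat)) : seq nat :=
  mkseq (fun e => \sum_(q <- L) on_path n q e)%N (2 * n - 3).

(* The elements of the semigroup of [Tree n] of multidegree [d], as lists of
   values on the edges. *)
Definition weights n (d : nat -> nat) (v : seq nat) : Prop :=
  exists L, [/\ all (fun q => q.1 < q.2 < n)%N L,
    forall i, (i < n)%N -> leaf_degree L i = d i & v = edge_weights n L].

Definition pair_of n (k : 'I_(nvars n)) : nat * nat :=
  (nat_of_ord (fst_leaf k), nat_of_ord (snd_leaf k)).

(** Stated for an arbitrary [F] so that leaf degrees and edge weights are transferred by the same
    list. *)
Lemma pairs_of_mono n (m : 'X_{1..nvars n}) :
  exists2 L, all (fun q => q.1 < q.2 < n)%N L &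
  forall F : nat * nat -> nat,
    (\sum_(q <- L) F q = \sum_k F (pair_of k) * m k)%N.
Proof.
exists (flatten [seq nseq (m k) (pair_of k) | k <- enum 'I_(nvars n)]).
  apply/allP => q /flattenP[_ /mapP[k _ ->] /nseqP[-> _]] /=.
  by rewrite ltn_ord (valP (enum_val k)).
move=> F; rewrite big_flatten big_map big_enum /=; apply: eq_bigr => k _.
by rewrite big_nseq iter_addn_0.
Qed.

Lemma mono_of_pairs n L : all (fun q => q.1 < q.2 < n)%N L ->
  exists m : 'X_{1..nvars n}, forall F : nat * nat -> nat,
    (\sum_(q <- L) F q = \sum_k F (pair_of k) * m k)%N.
Proof.
elim: L => [_|[i j] L IHL /= /andP[/andP[lt_ij lt_j]] /IHL[m mE]].
  by exists 0%MM => F; rewrite big_nil big1 // => k _; rewrite mnm0E muln0.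
have lt_i := ltn_trans lt_ij lt_j.
pose q : leaf_pair n := exist _ (Ordinal lt_i, Ordinal lt_j) lt_ij.
exists (U_(enum_rank q) + m)%MM => F; rewrite big_cons mE.
under [RHS]eq_bigr do rewrite mnmDE mnm1E mulnDr.
rewrite big_split /=; congr (_ + _)%N.
rewrite (bigD1 (enum_rank q)) //= eqxx muln1 big1 => [|k].
  by rewrite addn0 /pair_of /fst_leaf /snd_leaf enum_rankK.
by rewrite eq_sym => /negPf ->; rewrite muln0.
Qed.

Section Hilbert.
Context (R : realType) (n : nat).
Local Notation C := R[i].
Local Notation N := (nvars n).

(** The exponents of the torus monomial obtained by pulling ['X_[m]] back along [monomial_map]. *)
Definition mono_weights (m : 'X_{1..N}) : seq nat :=
  mkseq (fun e => \sum_k on_path n (pair_of k) e * m k)%N (2 * n - 3).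

Lemma meval_monomial_map (t : 'I_(2 * n - 3) -> C) (m : 'X_{1..N}) :
  'X_[m].@[monomial_map t] = \prod_e t e ^+ nth 0%N (mono_weights m) e.
Proof.
rewrite mevalX; under [LHS]eq_bigr do rewrite /monomial_map -prodrXl.
rewrite exchange_big; apply: eq_bigr => e _ /=; rewrite nth_mkseq //.
rewrite -prodrXr; apply: eq_bigr => k _; rewrite mxE -exprM.
by [].
Qed.

(** The zero locus of [p] is closed, so if it contains the image of the torus it contains the
    closure of that image. *)
Lemma X_idealP (p : {mpoly C[N]}) :
  X_ideal p <-> forall t, torus t -> p.@[monomial_map t] = 0.
Proof.
split=> [/asboolP p0 t tt|p0].
  apply: p0; apply: (sub_gen_smallest (G := monomial_map (n := n) @` torus (n := n))).
  by exists t.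
apply/asboolP => v Xv.
have /(_ v Xv) : X_aff (n := n) `<=` zero_locus [set p].
  apply: smallest_sub; first by exists [set p].
  by move=> _ [t tt <-] _ ->; apply: p0.
exact.
Qed.

Lemma class_of_eq (p q : {mpoly C[N]}) :
  class_of p = class_of q <-> X_ideal (p - q).
Proof.
split=> [/eqP|pq]; last apply/eqP.
  by rewrite -Quotient.idealrBE.
by rewrite -Quotient.idealrBE.
Qed.

Lemma mono_degreeE (m : 'X_{1..N}) (mu : 'X_{1..n}) :
  mono_degree m = \row_i (mu i)%:Z <->
  forall i : 'I_n, (\sum_k (((pair_of k).1 == i) + ((pair_of k).2 == i)) * m k = mu i)%N.
Proof.
have degE i : mono_degree m ord0 i =
    (\sum_k (((pair_of k).1 == i) + ((pair_of k).2 == i)) * m k)%N%:Z.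
  rewrite /mono_degree summxE (big_morph Posz PoszD (erefl _)).
  apply: eq_bigr => k _; rewrite mulmxnE !mxE eqxx /= PoszM PoszD -!natz.
  by rewrite mulr_natr ![i == _]eq_sym.
split=> [deg_m i|deg_m]; last by apply/rowP => i; rewrite degE mxE deg_m.
by apply/eqP; rewrite -eqz_nat -degE deg_m mxE.
Qed.

Lemma weightsE (mu : 'X_{1..n}) v : weights n (nth 0%N mu) v <->
  exists2 m : 'X_{1..N}, mono_degree m = \row_i (mu i)%:Z & v = mono_weights m.
Proof.
split=> [[L [okL degL ->]]|[m /mono_degreeE deg_m ->]].
  have [m mE] := mono_of_pairs okL; exists m.
    apply/mono_degreeE => i.
    by rewrite -(mE (fun q => (q.1 == i) + (q.2 == i))%N) (mnm_nth 0%N) -degL.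
  by apply: eq_mkseq => e; rewrite (mE (fun q => nat_of_bool (on_path n q e))).
have [L okL LE] := pairs_of_mono m; exists L; split=> // [i lt_i|].
  rewrite /leaf_degree (LE (fun q => (q.1 == i) + (q.2 == i))%N).
  by rewrite (deg_m (Ordinal lt_i)) (mnm_nth 0%N).
by apply: eq_mkseq => e; rewrite (LE (fun q => nat_of_bool (on_path n q e))).
Qed.

(** Choosing one monomial for each weight gives a basis of the graded piece: the choices restrict to
    distinct monomials on the torus, and every other monomial of this degree agrees there with the
    one chosen for its weight. *)
Lemma hilbert_seriesE (mu : 'X_{1..n}) (s : seq (seq nat)) : uniq s ->
  (forall v, v \in s <-> weights n (nth 0%N mu) v) ->
  hilbert_series R n mu = (size s)%:Z.
Proof.
move=> uniq_s mem_s; congr Posz; apply: dim_unique.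
have /choice[m mE] (i : 'I_(size s)) : exists m : 'X_{1..N},
    mono_degree m = \row_i (mu i)%:Z /\ nth [::] s i = mono_weights m.
  have /mem_s/weightsE[m deg_m wt_m] : nth [::] s i \in s by rewrite mem_nth.
  by exists m.
pose b i : coord_ring R n := class_of 'X_[m i].
pose span x := exists c : 'I_(size s) -> C, x = \sum_i c i *: b i.
exists b; split.
  move=> c sum0 i.
  (* A relation between the classes is a polynomial vanishing on the image of the torus, that is, a
     relation between distinct torus monomials. *)
  have /class_of_eq/X_idealP ideal_sum :
      class_of (\sum_i c i *: 'X_[m i]) = class_of (0 : {mpoly C[N]}).
    rewrite [RHS]rmorph0 -sum0 [LHS]rmorph_sum; apply: eq_bigr => j _.
    exact: class_ofZ.
  apply: (@monomials_free _ _ _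
    (fun i e => nth 0%N (mono_weights (m i)) e) (enum 'I_(size s))).
  - move=> j k eq_jk; apply/val_inj/eqP => /=.
    rewrite -(nth_uniq [::] _ _ uniq_s) // (mE j).2 (mE k).2.
    apply/eqP/(@eq_from_nth _ 0%N); rewrite !size_mkseq // => e lt_e.
    exact: (eq_jk (Ordinal lt_e)).
  - exact: enum_uniq.
  - move=> t tt; rewrite big_enum /=.
    have := ideal_sum t tt; rewrite subr0 raddf_sum => {2}<-.
    by apply: eq_bigr => j _; rewrite /= mevalZ meval_monomial_map.
  - exact: mem_enum.
apply/seteqP; split=> [_ [p hom_p <-]|_ [c _ <-]]; last first.
  exists (\sum_i c i *: 'X_[m i]).
    move=> k; rewrite mcoeff_msupp => nz_k.
    have [[i /eqP <-]|nm] := pselect (exists i, m i == k); first exact: (mE i).1.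
    case/eqP: nz_k; rewrite raddf_sum big1 // => i _ /=.
    by rewrite mcoeffZ mcoeffX; case: eqP => [Ek|]; [case: nm; exists i; apply/eqP|rewrite mulr0].
  rewrite [LHS]rmorph_sum; apply: eq_bigr => j _; exact: class_ofZ.
suff [c ->] : span (class_of p) by exists c.
rewrite [p]mpolyE [class_of _]rmorph_sum big_seq; apply: big_ind.
- by exists (fun=> 0); rewrite big1 // => i _; rewrite scale0r.
- move=> _ _ [c ->] [d ->]; exists (fun i => c i + d i).
  by rewrite -big_split; apply: eq_bigr => i _; rewrite scalerDl.
move=> k /hom_p deg_k.
have /mem_s ks : weights n (nth 0%N mu) (mono_weights k) by apply/weightsE; exists k.
have lt_k : (index (mono_weights k) s < size s)%N by rewrite index_mem.
(* The position of the chosen monomial with the same weights as [k]. *)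
pose i0 := Ordinal lt_k.
have Ek : class_of (p@_k *: 'X_[k]) = p@_k *: b i0.
  rewrite -class_ofZ; apply/class_of_eq/X_idealP => t tt.
  rewrite mevalB !mevalZ !meval_monomial_map -(mE i0).2 nth_index //.
  exact: subrr.
exists (fun i => if i == i0 then p@_k else 0).
rewrite [LHS]Ek (bigD1 i0) //= eqxx big1 ?addr0 // => i /negPf ->.
by rewrite scale0r.
Qed.

End Hilbert.

(** Each pair contributes to the degree at its larger leaf, so a list has at most [B] pairs and no
    edge value exceeds [B]. The weights thus lie among finitely many tuples. *)
Lemma weights_finite n d : (0 < n)%N ->
  exists2 s, uniq s & forall v, v \in s <-> weights n d v.
Proof.
move=> n_gt0; pose B := (\sum_(i < n) d i)%N.
pose vals (t : (2 * n - 3).-tuple 'I_B.+1) : seq nat := map val t.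
exists [seq v <- map vals (enum {: (2 * n - 3).-tuple 'I_B.+1}) | `[< weights n d v >]].
  rewrite filter_uniq // map_inj_uniq ?enum_uniq // => t u.
  by move/(inj_map val_inj)/val_inj.
move=> v; rewrite mem_filter; split=> [/andP[/asboolP //]|wv].
rewrite asboolT //=; have [L [okL degL Ev]] := wv.
have szv : size v == (2 * n - 3)%N by rewrite Ev size_mkseq.
have szL : (size L <= B)%N.
  rewrite /B -sum1_size; under [X in (_ <= X)%N]eq_bigr => i _ do
    rewrite -degL ?ltn_ord // /leaf_degree.
  rewrite exchange_big /= !big_seq; apply: leq_sum => q /(allP okL) /andP[lt1 lt2].
  by rewrite (bigD1 (Ordinal lt2)) //= eqxx addn1.
have ltv e : (nth 0%N v e < B.+1)%N.
  rewrite ltnS; apply: leq_trans szL; have [lt_e|] := ltnP e (2 * n - 3)%N.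
    by rewrite Ev nth_mkseq // -sum1_size leq_sum // => q _; case: on_path.
  by rewrite -(eqP szv) => /(nth_default 0%N) ->.
pose t := [tuple inord (nth 0%N v i) : 'I_B.+1 | i < 2 * n - 3].
apply/mapP; exists t; rewrite ?mem_enum //.
apply: (@eq_from_nth _ 0%N) => [|e]; rewrite (eqP szv).
  by rewrite size_map size_tuple.
move=> lt_e.
rewrite (nth_map ord0) ?size_tuple // -[e]/(val (Ordinal lt_e)) -tnth_nth tnth_mktuple.
by rewrite /= inordK.
Qed.

(** * Weights of [Tree n.+1] *)

Local Open Scope nat_scope.

Lemma eq_weights n d d' v : (forall i, i < n -> d i = d' i) ->
  weights n d v -> weights n d' v.
Proof. by move=> dd' [L [okL degL ->]]; exists L; split=> // i lt_i; rewrite degL ?dd'. Qed.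

(* Merges the leaves [n.-1] and [n], numbered from 0, of [Tree n.+1] into the
   last leaf of [Tree n]. *)
Definition merge_leaves n (q : nat * nat) : nat * nat := (q.1, minn q.2 n.-1).

Section WeightsRecursion.
Context (n : nat).
Hypothesis n_ge3 : 3 <= n.
Implicit Types (L : seq (nat * nat)) (d : nat -> nat).

(** The last two edges are the pendant edges of leaves [n.-1] and [n], so they carry the degrees
    there. On the old edges the pair [(n.-1, n)] counts for nothing and any other pair counts as its
    merged pair. *)
Lemma edge_weights_cherry L : all (fun q => q.1 < q.2 < n.+1) L ->
  edge_weights n.+1 L =
  mkseq (fun e => \sum_(q <- L) (q.1 < n.-1) && on_path n (merge_leaves n q) e)
    (2 * n - 3) ++ [:: leaf_degree L n.-1; leaf_degree L n].
Proof.
move=> okL; rewrite /edge_weights (_ : 2 * n.+1 - 3 = (2 * n - 3) + 2); last by lia.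
rewrite /mkseq iotaD map_cat /= add0n; congr (_ ++ [:: _; _]).
- apply/eq_in_map => e; rewrite mem_iota => lt_e.
  rewrite !big_seq; apply: eq_bigr => -[i j] /(allP okL) ij.
  by rewrite on_path_old.
- rewrite /leaf_degree !big_seq; apply: eq_bigr => -[i j] /(allP okL) /= ij.
  by rewrite on_path_new //; lia.
- rewrite /leaf_degree !big_seq; apply: eq_bigr => -[i j] /(allP okL) /= ij.
  have -> : (2 * n - 3).+1 = 2 * n.+1 - 4 by lia.
  by rewrite on_path_last //; lia.
Qed.

Lemma leaf_degree_merge L i : all (fun q => (q.1 < n.-1) && (q.1 < q.2 < n.+1)) L ->
  leaf_degree (map (merge_leaves n) L) i =
  if i < n.-1 then leaf_degree L i else
  if i == n.-1 then leaf_degree L n.-1 + leaf_degree L n else 0.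
Proof.
move=> okL; rewrite /leaf_degree -big_split big_map /=.
transitivity (\sum_(q <- L) if i < n.-1 then (q.1 == i) + (q.2 == i) else
   if i == n.-1 then (q.1 == n.-1) + (q.2 == n.-1) + ((q.1 == n) + (q.2 == n)) else 0).
  rewrite !big_seq; apply: eq_bigr => -[a b] /(allP okL) /= ab.
  have [lt_i|le_i] := ltnP i n.-1; first by lia.
  by have [->|ne_i] := eqVneq i n.-1; lia.
by case: ifP => // _; case: ifP => // _; rewrite big1.
Qed.

Lemma edge_weights_merge L : all (fun q => (q.1 < n.-1) && (q.1 < q.2 < n.+1)) L ->
  edge_weights n.+1 L = edge_weights n (map (merge_leaves n) L) ++
    [:: leaf_degree L n.-1; leaf_degree L n].
Proof.
move=> okL; rewrite edge_weights_cherry; last first.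
  by apply/allP => q /(allP okL) /andP[].
congr (_ ++ _); apply: eq_mkseq => e; rewrite big_map !big_seq.
by apply: eq_bigr => q /(allP okL) /andP[-> _].
Qed.

(** Going through the list, ends at the last leaf are sent to leaf [n.-1] until [p] of them are used
    up, and to leaf [n] afterwards. *)
Lemma split_last_leaf L (p q : nat) : all (fun q => q.1 < q.2 < n) L ->
  leaf_degree L n.-1 = p + q ->
  exists L', [/\ all (fun q => (q.1 < n.-1) && (q.1 < q.2 < n.+1)) L',
    map (merge_leaves n) L' = L, leaf_degree L' n.-1 = p & leaf_degree L' n = q].
Proof.
elim: L p q => [|[i j] L IHL] p q /=.
  rewrite {1}/leaf_degree big_nil => _ /eqP; rewrite eq_sym addn_eq0.
  by move=> /andP[/eqP -> /eqP ->]; exists [::]; rewrite /leaf_degree !big_nil.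
move=> /andP[ij /IHL{}IHL]; rewrite {1}/leaf_degree big_cons -/(leaf_degree L n.-1) /=.
move=> deg_n; suff [j' [p' [q' [ij' <- degL <- <-]]]] : exists j' p' q',
    [/\ i < j' < n.+1, minn j' n.-1 = j, leaf_degree L n.-1 = p' + q',
     (j' == n.-1) + p' = p & (j' == n) + q' = q].
  have [L' [okL' <- <- <-]] := IHL _ _ degL; exists ((i, j') :: L').
  split=> //=; first by rewrite okL' andbT; lia.
    by rewrite /leaf_degree big_cons /=; congr (_ + _); lia.
  by rewrite /leaf_degree big_cons /=; congr (_ + _); lia.
have [lt_j|le_j] := ltnP j n.-1.
  by exists j, p, q; split; lia.
case: p => [|p] in deg_n *.
  (* Here the pair itself ends at the last leaf while [p] is 0, so [q] is positive. *)
  by exists n, 0, q.-1; split; lia.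
by exists n.-1, p, q; split; lia.
Qed.

(** The cases are whether [(n.-1, n)] occurs in the list. Its path consists of the two new edges, so
    removing or adding it changes only the last two values; hence [take] keeps the old edges and the
    degrees are appended anew. *)
Lemma weights_cherry d v : weights n.+1 d v <->
  (exists2 u, weights n (fun i => if i == n.-1 then d n.-1 + d n else d i) u &
     v = u ++ [:: d n.-1; d n]) \/
  [/\ 0 < d n.-1, 0 < d n &
   exists2 u, weights n.+1 (fun i => if n.-1 <= i then (d i).-1 else d i) u &
     v = take (2 * n - 3) u ++ [:: d n.-1; d n]].
Proof.
have consE i L : leaf_degree ((n.-1, n) :: L) i =
    (n.-1 == i) + (n == i) + leaf_degree L i.
  by rewrite /leaf_degree big_cons.
split=> [[L [okL degL ->]]|[[u [L [okL degL ->]] ->]|[p_gt0 q_gt0]]].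
- have [inL|notinL] := boolP ((n.-1, n) \in L).
    right; have permL := perm_to_rem inL; set L1 := rem _ L in permL.
    have degL1 i : i < n.+1 -> (n.-1 == i) + (n == i) + leaf_degree L1 i = d i.
      by move=> lt_i; rewrite -consE -degL // /leaf_degree (perm_big _ permL).
    have okL1 : all (fun q => q.1 < q.2 < n.+1) L1.
      by apply/allP => q /mem_rem /(allP okL).
    split.
    + by rewrite -degL1 ?eqxx; lia.
    + by rewrite -degL1 ?eqxx ?addn1 //; lia.
    exists (edge_weights n.+1 L1).
      by exists L1; split=> // i lt_i; have := degL1 i lt_i; case: ifP; lia.
    rewrite !edge_weights_cherry // take_size_cat ?size_mkseq // -!degL //; last lia.
    congr (_ ++ _); apply: eq_mkseq => e; rewrite (perm_big _ permL) /=.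
    by rewrite big_cons ltnn.
  (* Only [(n.-1, n)] has a first leaf that is not below [n.-1]; without it, merging yields genuine
     pairs of leaves. *)
  left; have okL' : all (fun q => (q.1 < n.-1) && (q.1 < q.2 < n.+1)) L.
    apply/allP => -[i j] ijL; have /= ij := allP okL _ ijL.
    rewrite ij andbT /=; have [//|le_i] := ltnP i n.-1.
    by case/negP: notinL; rewrite (_ : (n.-1, n) = (i, j)) //; congr pair; lia.
  exists (edge_weights n (map (merge_leaves n) L)).
    exists (map (merge_leaves n) L); split=> //.
      by apply/allP => _ /mapP[q /(allP okL') + ->] /=; lia.
    move=> i lt_i; rewrite leaf_degree_merge // -!degL //; try lia.
    have [lt_in|le_in] := ltnP i n.-1; first by rewrite ltn_eqF // degL //; lia.
    by have -> : i == n.-1 by lia.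
  by rewrite edge_weights_merge // !degL //; lia.
- have := degL n.-1; rewrite eqxx => degn.
  have [|L' [okL' EL degp degq]] := split_last_leaf okL (degn _); first by lia.
  exists L'; rewrite edge_weights_merge // EL degp degq; split=> //.
    by apply/allP => q /(allP okL') /andP[].
  move=> i lt_i; have := leaf_degree_merge i okL'; rewrite EL.
  have [lt_in <-|le_in _] := ltnP i n.-1.
    by rewrite degL; [rewrite ltn_eqF|lia].
  by have [->|ne_i] := eqVneq i n.-1; last (have -> : i = n by lia).
(* Both degrees are positive, so adding the pair back undoes the predecessors. *)
- case=> u [L [okL degL ->]] ->.
  have okL' : all (fun q => q.1 < q.2 < n.+1) ((n.-1, n) :: L).
    by rewrite /= okL andbT; lia.
  have degL' i : i < n.+1 -> leaf_degree ((n.-1, n) :: L) i = d i.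
    move=> lt_i; rewrite consE degL //; have [le_i|lt_in] := leqP n.-1 i; last by lia.
    by have [->|ne_i] := eqVneq i n.-1; last (have -> : i = n by lia); lia.
  exists ((n.-1, n) :: L); split=> //.
  rewrite !edge_weights_cherry // take_size_cat ?size_mkseq // !degL' //; last by lia.
  by congr (_ ++ _); apply: eq_mkseq => e; rewrite big_cons ltnn.
Qed.

Lemma weights_last_edge d u : weights n d u -> nth 0 u (2 * n - 4) = d n.-1.
Proof.
case=> L [okL degL ->]; rewrite nth_mkseq; last by lia.
rewrite -degL; last by lia.
rewrite /leaf_degree !big_seq; apply: eq_bigr => -[i j] /(allP okL) /= ij.
by rewrite on_path_last //; lia.
Qed.

(** Edge [2 * n - 4] now lies below the cherry, so each path through it has an end at leaf [n.-1] or
    [n]. Together with the exact value in the smaller tree this separates the two cases of the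
    recursion. *)
Lemma weights_cherry_last_edge d u :
  weights n.+1 d u -> nth 0 u (2 * n - 4) <= d n.-1 + d n.
Proof.
case=> L [okL degL ->]; rewrite edge_weights_cherry // nth_cat size_mkseq.
have lt_e : 2 * n - 4 < 2 * n - 3 by lia.
rewrite lt_e nth_mkseq // -!degL //; last by lia.
rewrite /leaf_degree -big_split !big_seq; apply: leq_sum => -[i j] /(allP okL) /= ij.
have [lt_i|//] := ltnP i n.-1; rewrite on_path_last //=; lia.
Qed.

(** The two ways of building weights are injective, have disjoint images, and together reach every
    weight, so the counts add. *)
Lemma size_weights_cherry d s s1 s2 :
  uniq s -> (forall v, v \in s <-> weights n.+1 d v) ->
  uniq s1 -> (forall v, v \in s1 <->
    weights n (fun i => if i == n.-1 then d n.-1 + d n else d i) v) ->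
  uniq s2 -> (forall v, v \in s2 <->
    weights n.+1 (fun i => if n.-1 <= i then (d i).-1 else d i) v) ->
  size s = size s1 + (if (0 < d n.-1) && (0 < d n) then size s2 else 0).
Proof.
move=> uniq_s mem_s uniq_s1 mem_s1 uniq_s2 mem_s2.
pose t1 := [seq u ++ [:: d n.-1; d n] | u <- s1].
pose t2 := [seq take (2 * n - 3) u ++ [:: d n.-1; d n] | u <- s2].
have perm_s : perm_eq s
    (t1 ++ (if (0 < d n.-1) && (0 < d n) then t2 else [::])).
  apply: uniq_perm => //.
    rewrite cat_uniq map_inj_in_uniq ?uniq_s1 /=; last first.
      move=> u u' /mem_s1[L [_ _ ->]] /mem_s1[L' [_ _ ->]] /eqP.
      by rewrite eqseq_cat ?size_mkseq // eqxx andbT => /eqP.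
    case: ifP => // /andP[p_gt0 q_gt0]; apply/andP; split.
      (* A common element would have at edge [2 * n - 4] both the value [d n.-1 + d n] and a value
         at most [(d n.-1).-1 + (d n).-1]. *)
      apply/hasPn => _ /mapP[u /mem_s2 wu ->]; apply/negP => /mapP[u' /mem_s1 wu'].
      have := weights_last_edge wu'; have := weights_cherry_last_edge wu.
      rewrite leqnn leq_pred eqxx => le_u eq_u'.
      have [L [_ _ Eu]] := wu; have [L' [_ _ Eu']] := wu'.
      move/(congr1 (fun v => nth 0 v (2 * n - 4))).
      have lt_e : 2 * n - 4 < 2 * n - 3 by lia.
      have size_u : size (take (2 * n - 3) u) = 2 * n - 3.
        by rewrite size_takel // Eu size_mkseq; lia.
      have size_u' : size u' = 2 * n - 3 by rewrite Eu' size_mkseq.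
      rewrite !nth_cat size_u size_u' lt_e nth_take // => Euu'.
      by move: le_u; rewrite Euu' eq_u'; lia.
    (* Dropping the last two values loses nothing, since the degrees determine them. *)
    rewrite map_inj_in_uniq // => u u' /mem_s2[L [okL degL ->]] /mem_s2[L' [okL' degL' ->]].
    rewrite !edge_weights_cherry // !take_size_cat ?size_mkseq //.
    move/eqP; rewrite eqseq_cat ?size_mkseq // eqxx andbT => /eqP ->.
    by rewrite !degL ?degL' //; lia.
  move=> v; rewrite mem_cat; apply/idP/orP.
    move/mem_s/weights_cherry => [[u /mem_s1 su ->]|[p_gt0 q_gt0 [u /mem_s2 su ->]]].
      by left; apply: map_f.
    by right; rewrite p_gt0 q_gt0; apply/mapP; exists u.
  case=> [/mapP[u /mem_s1 wu ->]|].
    by apply/mem_s/weights_cherry; left; exists u.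
  case: ifP => // /andP[p_gt0 q_gt0] /mapP[u /mem_s2 wu ->].
  by apply/mem_s/weights_cherry; right; split=> //; exists u.
by rewrite (perm_size perm_s) size_cat size_map; case: ifP; rewrite ?size_map.
Qed.

End WeightsRecursion.

(** * The recursion of power series *)

Local Open Scope ring_scope.

Lemma fps_monM m (a b : 'X_{1..m}) : fps_mon a * fps_mon b = fps_mon (a + b)%MM.
Proof.
apply/funext => mu; rewrite fps_mulXE /fps_mon.
case: ifPn => [le_b|nle_b]; first by rewrite -(eqm_add2r b) submK.
by case: eqP => // eq_mu; rewrite eq_mu lem_addl in nle_b.
Qed.

Lemma fps_sumE m (I : Type) (r : seq I) (P : pred I) (F : I -> fps m) mu :
  (\sum_(i <- r | P i) F i) mu = \sum_(i <- r | P i) F i mu.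
Proof. by apply: (big_morph (fun f : fps m => f mu)). Qed.

(** * Coefficients with respect to the last two variables *)

Section LastTwoVariables.
Context (n : nat).
Hypothesis n_gt0 : (0 < n)%N.
Implicit Types mu : 'X_{1..n.+1}.

(** The exponent of [z_n^p z_(n+1)^q]; positions count from 0, so [z_n] sits where [i.+1 == n]. *)
Definition mnm_last2 (p q : nat) : 'X_{1..n.+1} :=
  [multinom (if i == n :> nat then q else if i.+1 == n then p else 0)%N | i < n.+1].

Lemma zvar_last2 p q :
  zvar n.+1 n ^+ p * zvar n.+1 n.+1 ^+ q = fps_mon (mnm_last2 p q).
Proof.
rewrite !fps_monX fps_monM; congr fps_mon; apply/mnmP => i.
rewrite mnmDE !mulmnE !mnmE eqSS; have [Ei|ne_i] := eqVneq (i : nat) n.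
  by rewrite Ei gtn_eqF // mul0n mul1n.
by case: eqP; rewrite ?mul1n ?mul0n ?addn0.
Qed.

Lemma mnm_last2_le p q mu :
  (mnm_last2 p q <= mu)%MM = (p <= nth 0 mu n.-1)%N && (q <= nth 0 mu n)%N.
Proof.
have lt_n1 : (n.-1 < n.+1)%N by rewrite ltnS leq_pred.
apply/mnm_lepP/andP => [le_mu|[le_p le_q] i].
  have := le_mu (Ordinal lt_n1); have := le_mu ord_max.
  by rewrite !mnmE !(mnm_nth 0%N) /= eqxx prednK // eqxx ltn_eqF // prednK.
rewrite mnmE (mnm_nth 0%N); have [-> //|_] := eqVneq (i : nat) n.
case: eqP => // En; have -> : i = n.-1 :> nat by lia.
exact: le_p.
Qed.

Lemma nth_sub_last2 p q mu i : (i <= n)%N ->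
  nth 0%N (mu - mnm_last2 p q)%MM i =
  (nth 0 mu i - (if i == n then q else if i.+1 == n then p else 0))%N.
Proof.
move=> le_i; have lt_i : (i < n.+1)%N by [].
by rewrite -!(mnm_nth 0%N _ (Ordinal lt_i)) mnmBE mnmE.
Qed.

(** The series [f] does not involve the last two variables, so their exponents in [mu] must be
    exactly [p] and [q]. *)
Lemma fps_widen_last2E (f : fps n.-1) p q mu :
  (fps_widen n.+1 f * (zvar n.+1 n ^+ p * zvar n.+1 n.+1 ^+ q)) mu =
  if (p == nth 0 mu n.-1)%N && (q == nth 0 mu n)%N
  then f [multinom nth 0%N mu i | i < n.-1] else 0.
Proof.
rewrite zvar_last2 fps_mulXE mnm_last2_le; case: ifPn => [|nle]; last first.
  case: ifP => // /andP[/eqP Ep /eqP Eq].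
  by rewrite Ep Eq !leqnn in nle.
move=> /andP[le_p le_q]; rewrite /fps_widen.
have -> : [forall j : 'I_n.+1, (n.-1 <= j)%N ==> ((mu - mnm_last2 p q)%MM j == 0%N)] =
    (p == nth 0 mu n.-1)%N && (q == nth 0 mu n)%N.
  have lt_n1 : (n.-1 < n.+1)%N by rewrite ltnS leq_pred.
  apply/forallP/andP => [mu0|[/eqP Ep /eqP Eq] j].
    have := mu0 (Ordinal lt_n1); have := mu0 ord_max.
    rewrite !(mnm_nth 0%N) !nth_sub_last2 ?leq_pred //= eqxx leqnn.
    rewrite prednK // eqxx [n.-1 == n]ltn_eqF ?ltn_predL //=.
    by move=> /eqP q0 /eqP p0; split; apply/eqP; lia.
  apply/implyP => le_j; rewrite (mnm_nth 0%N) nth_sub_last2; last by rewrite -ltnS.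
  have [->|ne_j] := eqVneq (j : nat) n; first by rewrite Eq subnn.
  have Ej : (j : nat) = n.-1 by have := ltn_ord j; lia.
  by rewrite Ej prednK // eqxx Ep subnn.
case: ifP => // _; congr f; apply/mnmP => i; rewrite !mnmE nth_sub_last2.
  by rewrite !ifF ?subn0 //; have := ltn_ord i; lia.
by have := ltn_ord i; lia.
Qed.

(** With [p] and [q] the last two exponents of [mu], only the term [i = p + q], [l = q] contributes.
    In particular the family is locally finite, and the default value of [fps_sum] does not
    intervene. *)
Lemma fps_sum_last2E (w : nat -> fps n.-1) mu :
  fps_sum (fun i => fps_widen n.+1 (w i) *
    \sum_(l < i.+1) zvar n.+1 n ^+ (i - l) * zvar n.+1 n.+1 ^+ l) mu =
  w (nth 0 mu n.-1 + nth 0 mu n)%N [multinom nth 0%N mu i | i < n.-1].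
Proof.
set p := nth 0%N mu n.-1; set q := nth 0%N mu n.
rewrite /fps_sum (eq_fsbigr (fun i => if i == (p + q)%N
    then w i [multinom nth 0%N mu i | i < n.-1] else 0)) => [|i _].
  rewrite -(@fsbig_widen _ _ _ _ [set (p + q)%N]%classic) ?fsbig_set1 ?eqxx //.
  by move=> i [_ /eqP/negPf] /= ->.
rewrite mulr_sumr fps_sumE; under eq_bigr do rewrite fps_widen_last2E -/p -/q.
case: eqP => [->|ne_i].
  have lt_q : (q < (p + q).+1)%N by rewrite ltnS leq_addl.
  rewrite (bigD1 (Ordinal lt_q)) //= addnK !eqxx big1 ?addr0 // => l.
  by rewrite -val_eqE /= => /negPf ->; rewrite andbF.
by apply: big1 => l _; case: ifP => // /andP[]; have := ltn_ord l; lia.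
Qed.

End LastTwoVariables.

(** The recursion for the counts, read on coefficients: the test on [mnm_last2 n 1 1] says that both
    last exponents are positive, and the subtraction lowers each by one. *)
Lemma hilbert_series_cherry (R : realType) n (mu : 'X_{1..n.+1}) : (3 <= n)%N ->
  hilbert_series R n.+1 mu =
  hilbert_series R n [multinom (if i == n.-1 :> nat
    then nth 0 mu n.-1 + nth 0 mu n else nth 0 mu i)%N | i < n] +
  (if (mnm_last2 n 1 1 <= mu)%MM
   then hilbert_series R n.+1 (mu - mnm_last2 n 1 1)%MM else 0).
Proof.
move=> n_ge3; have n_gt0 : (0 < n)%N by lia.
set mu1 : 'X_{1..n} := [multinom _ | _ < n]; set mu2 := (mu - _)%MM.
have [s uniq_s mem_s] := @weights_finite n.+1 (nth 0%N mu) isT.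
have [s1 uniq_s1 mem_s1] := weights_finite (fun i => if i == n.-1
  then nth 0 mu n.-1 + nth 0 mu n else nth 0 mu i)%N n_gt0.
have [s2 uniq_s2 mem_s2] := @weights_finite n.+1 (fun i => if (n.-1 <= i)%N
  then (nth 0 mu i).-1 else nth 0 mu i)%N isT.
rewrite (hilbert_seriesE R uniq_s mem_s).
rewrite (hilbert_seriesE R uniq_s1 (mu := mu1)) => [|v]; last first.
  rewrite mem_s1; split; apply: eq_weights => i lt_i;
    by rewrite -(mnm_nth 0%N _ (Ordinal lt_i)) mnmE.
rewrite (hilbert_seriesE R uniq_s2 (mu := mu2)) => [|v]; last first.
  have mu2E i : (i < n.+1)%N ->
      nth 0%N mu2 i = (if n.-1 <= i then (nth 0 mu i).-1 else nth 0 mu i)%N.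
    rewrite ltnS => le_i; rewrite nth_sub_last2 //.
    have [->|ne_i] := eqVneq i n; first by rewrite leq_pred subn1.
    rewrite (_ : (i.+1 == n) = (n.-1 <= i)%N); last by lia.
    by case: leqP; rewrite ?subn1 ?subn0.
  by rewrite mem_s2; split; apply: eq_weights => i /mu2E.
rewrite (size_weights_cherry n_ge3 uniq_s mem_s uniq_s1 mem_s1 uniq_s2 mem_s2).
by rewrite mnm_last2_le // PoszD; case: ifP.
Qed.

Theorem theorem3p4p3 (R : realType) (n : nat) (hn : (3 <= n)%N)
    (w : nat -> fps n.-1) :
  hilbert_series R n = fps_sum (fun i => fps_widen n (w i) * zvar n n ^+ i) ->
  hilbert_series R n.+1 =
    fps_sum (fun i => fps_widen n.+1 (w i) *
      \sum_(l < i.+1) zvar n.+1 n ^+ (i - l) * zvar n.+1 n.+1 ^+ l)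
    / (1 - zvar n.+1 n * zvar n.+1 n.+1).
Proof.
move=> hilbert_n; have n_gt0 : (0 < n)%N by apply: leq_trans hn.
have zvarE : zvar n.+1 n * zvar n.+1 n.+1 = fps_mon (mnm_last2 n 1 1).
  by rewrite -zvar_last2 // !expr1.
(* The inverse of a non-unit is by convention the series itself, so the quotient has its intended
   meaning only after this check. *)
have unit_z : 1 - zvar n.+1 n * zvar n.+1 n.+1 \is a GRing.unit.
  apply: fps_unit_sub1; rewrite zvarE /fps_mon; case: eqP => // /mnmP/(_ ord_max).
  by rewrite !mnmE /= eqxx.
(* With the denominator cleared, the left side at [mu] is the coefficient at [mu] minus the one with
   both last exponents lowered, which the recursion evaluates. *)
apply: (mulIr unit_z); rewrite divrK //; apply/funext => mu.
rewrite mulrBr mulr1 zvarE -[LHS]/(_ - _) fps_mulXE fps_sum_last2E //.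
rewrite hilbert_series_cherry // addrK hilbert_n.
(* Writing [n] as a successor lets [n.-1] compute, so that the expansion in the last variable can be
   read off; both sides are then a coefficient of [w] at the sum of the last two exponents. *)
case: n hn w hilbert_n n_gt0 {zvarE unit_z} mu => // n hn w _ _ mu /=.
rewrite fps_sum_lastE mnmE eqxx; congr (w _ _).
apply/mnmP => i; rewrite !mnmE -(mnm_nth 0%N _ (widen_ord (leqnSn n) i)) mnmE /=.
by rewrite ltn_eqF.
Qed.
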